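(* Let $\mathbf{a}:I\to\mathbb{R}^{2r}$ be a differentiable solution, on a time interval $I$, of the reduced order model (POD-ROM-II) $$\mathbf{U}^T\mathcal{L}_h^{*}\mathbf{U}\,\frac{d\mathbf{a}(t)}{dt}=-\mathbf{U}^T\mathcal{L}_h^{*}\,\mathcal{N}_h\big(\mathbf{U}\mathbf{a}(t)\big)\,\mathcal{L}_h\big[\mathbf{U}\mathbf{a}(t)\big].$$ Then, with the discrete energy $\mathcal{E}_r(\mathbf{U}\mathbf{a})=\frac12[\mathbf{U}\mathbf{a}]^T\mathcal{L}_h[\mathbf{U}\mathbf{a}]$, the energy dissipation law $$\frac{d\,\mathcal{E}_r(\mathbf{U}\mathbf{a}(t))}{dt}=-\Big(\mathcal{L}_h[\mathbf{U}\mathbf{a}(t)],\ \mathcal{N}_h\big(\mathbf{U}\mathbf{a}(t)\big)\mathcal{L}_h[\mathbf{U}\mathbf{a}(t)]\Big)\le 0$$ holds for all $t\in I$.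
   Context: Setting (spatially discretized, energy-quadratized system). Let $N\ge 1$ be the number of spatial grid points and $1\le r\le N$. The full discrete state is $\Psi=\begin{bmatrix}\phi\\ q\end{bmatrix}\in\mathbb{R}^{2N}$ with $\phi,q\in\mathbb{R}^N$. The bracket $(x,y)=x^Ty$ is the Euclidean inner product on $\mathbb{R}^{2N}$. Linear operator: $\mathcal{L}_h=\begin{bmatrix}\mathcal{L}_{0,h}&0\\0&\mathbf{I}_N\end{bmatrix}$, where $\mathcal{L}_{0,h}\in\mathbb{R}^{N\times N}$ is symmetric, positive semi-definite and invertible (hence positive definite); $\mathcal{L}_h^{*}=\mathcal{L}_h^T$ denotes its adjoint. Mobility: $\mathcal{N}_h(\Psi)=\mathcal{N}_0(\Psi)^T(\mathcal{G}_a+\mathcal{G}_s)\mathcal{N}_0(\Psi)\in\mathbb{R}^{2N\times 2N}$, where $\mathcal{G}_a\in\mathbb{R}^{N\times N}$ is skew-symmetric, $\mathcal{G}_s\in\mathbb{R}^{N\times N}$ is symmetric positive semi-definite, and $\mathcal{N}_0(\Psi)=\begin{bmatrix}\mathbf{I}_N & \mathrm{diag}(g(\phi))\end{bmatrix}\in\mathbb{R}^{N\times 2N}$ with $g:\mathbb{R}\to\mathbb{R}$ a given function applied componentwise to $\phi$. Reduced basis: $\mathbf{U}=\begin{bmatrix}\mathbf{U}_\phi&0\\0&\mathbf{U}_q\end{bmatrix}\in\mathbb{R}^{2N\times 2r}$, where $\mathbf{U}_\phi,\mathbf{U}_q\in\mathbb{R}^{N\times r}$ have orthonormal columns (leading left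 singular vectors of snapshot matrices), so $\mathbf{U}^T\mathbf{U}=\mathbf{I}_{2r}$. The reduced unknown is $\mathbf{a}=\begin{bmatrix}\mathbf{a}_\phi\\ \mathbf{a}_q\end{bmatrix}\in\mathbb{R}^{2r}$. *)

(* Defs.v *)
From HB Require Import structures.
From mathcomp Require Import all_boot all_order all_algebra.
From mathcomp Require Import all_classical all_reals all_analysis.

Set Implicit Arguments.
Unset Strict Implicit.
Unset Printing Implicit Defensive.

Import Order.TTheory GRing.Theory Num.Theory.
Import numFieldNormedType.Exports.

Local Open Scope classical_set_scope.
Local Open Scope ring_scope.

(* [l] is the derivative at [t] of the restriction of [f] to [I]: the difference
   quotient tends to [l] as [s -> t] with [s \in I], [s != t]. It is one-sided
   at an endpoint belonging to [I], and agrees with [is_derive] in the interior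
   ([is_derive_inE]). Pitfall: it says nothing when [t] is isolated in [I],
   i.e. when [I] is reduced to a point. *)
Definition is_derive_in (R : realType) (V : normedModType R)
    (I : interval R) (f : R -> V) (t : R) (l : V) : Prop :=
  (s - t)^-1 *: (f s - f t) @[s --> within [set` I] t^'] --> l.

Lemma is_derive_inE (R : realType) (V : normedModType R)
    (I : interval R) (f : R -> V) (t : R) (l : V) :
  nbhs t [set` I] -> is_derive_in I f t l <-> is_derive t 1 f l.
Proof.
move=> tI; pose F s := (s - t)^-1 *: (f s - f t).
have quotE : (h^-1 *: ((f \o shift t) (h *: 1) - f t) @[h --> 0^']) =
    (F s @[s --> within [set` I] t^']).
  apply/predeqP => A; rewrite /within/= !nbhs_simpl/=.
  change ((\forall h \near (0 : R), h != 0 ->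
      A (h^-1 *: ((f \o shift t) (h *: 1) - f t))) <->
    (\forall s \near t, s != t -> [set` I] s -> A (F s))).
  rewrite [X in _ <-> X]nbhs0P; split=> H.
    near=> h => th Ith.
    have : h != 0 -> A (h^-1 *: ((f \o shift t) (h *: 1) - f t)) by near: h.
    rewrite /F [h *: 1]mulr1 /shift/= (addrC t h) addrK; apply.
    by apply: contra_neq th => ->; rewrite addr0.
  have /nbhs0P tI0 := tI.
  near=> h => h0; rewrite [h *: 1]mulr1 /shift/=.
  have : t + h != t -> [set` I] (t + h) -> A (F (t + h)) by near: h.
  rewrite /F addrAC subrr add0r (addrC t h); apply.
    by rewrite -subr_eq0 addrK.
  by rewrite addrC; near: h.
split=> [dl|[df <-]]; last by rewrite /is_derive_in -quotE; exact: df.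
rewrite /is_derive_in -quotE in dl.
by apply: DeriveDef; [apply/cvg_ex; exists l | exact: cvg_lim dl].
Unshelve. all: by end_near. Qed.

Definition inner (R : realType) (n : nat) (x y : 'cV[R]_n) : R :=
  (x^T *m y) 0 0.

Definition psdmx (R : realType) (n : nat) (A : 'M[R]_n) : Prop :=
  A \is symmetricmx /\ forall v : 'cV[R]_n, 0 <= inner v (A *m v).

Section EnergyQuadratizedSystem.
Variables (R : realType) (N : nat).
Implicit Types (Psi : 'cV[R]_(N + N)).

Definition linop (L0 : 'M[R]_N) : 'M[R]_(N + N) := block_mx L0 0 0 1%:M.

(* [I_N  diag(g(phi))], where phi = [usubmx Psi] is the upper half of Psi. *)
Definition mobility0 (g : R -> R) Psi : 'M[R]_(N, N + N) :=
  row_mx 1%:M (diag_mx (map_mx g (usubmx Psi)^T)).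

Definition mobility (Ga Gs : 'M[R]_N) (g : R -> R) Psi : 'M[R]_(N + N) :=
  (mobility0 g Psi)^T *m (Ga + Gs) *m mobility0 g Psi.

Definition energy (L : 'M[R]_(N + N)) Psi : R :=
  2^-1 * (Psi^T *m L *m Psi) 0 0.

Definition reduced_basis (r : nat) (Uphi Uq : 'M[R]_(N, r)) :
    'M[R]_(N + N, r + r) :=
  block_mx Uphi 0 0 Uq.

(* The adjoint of [L] for the Euclidean bracket is its transpose. *)
Definition pod_rom_II_solution (r : nat) (L : 'M[R]_(N + N))
    (M : 'cV[R]_(N + N) -> 'M[R]_(N + N)) (U : 'M[R]_(N + N, r + r))
    (I : interval R) (a : R -> 'cV[R]_(r + r)) : Prop :=
  forall t : R, t \in I ->
    exists2 da : 'cV[R]_(r + r), is_derive_in I a t da &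
      U^T *m L^T *m U *m da
      = - (U^T *m L^T *m M (U *m a t) *m (L *m (U *m a t))).

End EnergyQuadratizedSystem.

(* Main.v *)
(* Write K = U^T L U, which is symmetric, so that E(a) = 1/2 a^T K a. The
   polarization identity x^T K x - y^T K y = (x - y)^T K (x + y) turns the
   difference quotient of the energy into 1/2 q^T K (2 a(t) + (s - t) q), with q
   the difference quotient of a, whence dE/dt = (da/dt)^T K a. Transposing and
   substituting the reduced model, in which the projected operator U^T L^T U is
   exactly K, gives - (L U a, M L U a). The sign holds since the skew part of the
   mobility does not contribute to its quadratic form. *)
Require Import Defs.
From HB Require Import structures.
From mathcomp Require Import all_boot all_order all_algebra.
From mathcomp Require Import all_classical all_reals all_analysis.

Set Implicit Arguments.
Unset Strict Implicit.
Unset Printing Implicit Defensive.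

Import Order.TTheory GRing.Theory Num.Theory.
Import numFieldNormedType.Exports.

Local Open Scope classical_set_scope.
Local Open Scope ring_scope.

Section Inner.
Variables (R : realType) (n : nat).
Implicit Types (x y z : 'cV[R]_n) (A : 'M[R]_n).

Lemma inner_sum x y : inner x y = \sum_i x i 0 * y i 0.
Proof. by rewrite /inner mxE; apply: eq_bigr => i _; rewrite mxE. Qed.

Lemma innerC x y : inner x y = inner y x.
Proof. by rewrite !inner_sum; apply: eq_bigr => i _; rewrite mulrC. Qed.

Lemma innerDl x y z : inner (x + y) z = inner x z + inner y z.
Proof. by rewrite /inner linearD/= mulmxDl mxE. Qed.

Lemma innerDr x y z : inner x (y + z) = inner x y + inner x z.
Proof. by rewrite /inner mulmxDr mxE. Qed.

Lemma innerZl (c : R) x y : inner (c *: x) y = c * inner x y.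
Proof. by rewrite /inner linearZ/= -scalemxAl mxE. Qed.

Lemma innerNl x y : inner (- x) y = - inner x y.
Proof. by rewrite -scaleN1r innerZl mulN1r. Qed.

Lemma innerNr x y : inner x (- y) = - inner x y.
Proof. by rewrite innerC innerNl innerC. Qed.

Lemma inner_mulmx m (B : 'M[R]_(n, m)) x (y : 'cV[R]_m) :
  inner x (B *m y) = inner (B^T *m x) y.
Proof. by rewrite /inner trmx_mul trmxK mulmxA. Qed.

(** On expanding the right-hand side, the two cross terms cancel because [A] is symmetric. *)
Lemma inner_polarization A x y : A^T = A ->
  inner x (A *m x) - inner y (A *m y) = inner (x - y) (A *m (x + y)).
Proof.
move=> At; rewrite innerDl innerNl mulmxDr !innerDr opprD addrACA.
have -> : inner x (A *m y) = inner y (A *m x).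
  by rewrite inner_mulmx At innerC.
by rewrite addrA subrK.
Qed.

(** Transposing the scalar x^T A x shows that it equals its own opposite, hence vanishes in
    characteristic zero. *)
Lemma inner_skew A x : A \is skewmx -> inner x (A *m x) = 0.
Proof.
move=> /is_hermitianmxP; rewrite expr1 scaleN1r map_mx_id// => At.
have /eqP : inner x (A *m x) = - inner x (A *m x).
  by rewrite {1}At mulNmx innerNr [in RHS]inner_mulmx [in RHS]innerC.
by rewrite -addr_eq0 -mulr2n mulrn_eq0/= => /eqP.
Qed.

End Inner.

Lemma trmx_symmetric (R : realType) n (A : 'M[R]_n) :
  A \is symmetricmx -> A^T = A.
Proof.
by move=> /is_hermitianmxP; rewrite expr0 scale1r map_mx_id// => <-.
Qed.

Section Convergence.
Variables (R : realType) (T : Type) (F : set_system T).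
Context {FF : Filter F}.

Lemma cvg_coord m n (f : T -> 'M[R]_(m, n)) (A : 'M[R]_(m, n)) i j :
  f @ F --> A -> f s i j @[s --> F] --> A i j.
Proof.
move=> fA.
exact: (cvg_comp f (fun B => B i j) fA (@coord_continuous _ m n i j A)).
Qed.

(** The form is a finite sum of products of coordinates, so limits pass through it. [F] is an
    arbitrary filter, possibly improper, so this covers punctured neighbourhoods within [I], even
    when [I] is a single point. *)
Lemma cvg_inner_mulmxr m n (A : 'M[R]_(m, n)) (f : T -> 'cV[R]_m)
    (g : T -> 'cV[R]_n) (x : 'cV[R]_m) (y : 'cV[R]_n) :
  f @ F --> x -> g @ F --> y ->
  inner (f s) (A *m g s) @[s --> F] --> inner x (A *m y).
Proof.
move=> fx gy; rewrite inner_sum; under eq_fun do rewrite inner_sum.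
apply: cvg_big => [|i _]; first exact: add_continuous.
apply: cvgM; first exact: cvg_coord.
rewrite mxE; under eq_fun do rewrite mxE.
apply: cvg_big => [|j _]; first exact: add_continuous.
by apply: cvgM; [exact: cvg_cst | exact: cvg_coord].
Qed.

End Convergence.

Lemma is_derive_in_quadratic (R : realType) n (K : 'M[R]_n) (I : interval R)
    (a : R -> 'cV[R]_n) (t : R) (da : 'cV[R]_n) :
  K^T = K -> is_derive_in I a t da ->
  is_derive_in I (fun s => 2^-1 * inner (a s) (K *m a s)) t
    (inner da (K *m a t)).
Proof.
move=> Kt dat; pose q s := (s - t)^-1 *: (a s - a t).
have quotE s : (s - t)^-1 *: (2^-1 * inner (a s) (K *m a s) -
      2^-1 * inner (a t) (K *m a t)) =
    2^-1 * inner (q s) (K *m (a t + a t + (s - t) *: q s)).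
  (* Also valid at s = t, where 0^-1 = 0 makes both sides vanish. *)
  have -> : (s - t) *: q s = a s - a t.
    have [->|st] := eqVneq s t; first by rewrite !subrr scale0r.
    by rewrite scalerA divff ?scale1r// subr_eq0.
  rewrite -mulrBr inner_polarization// innerZl mulrCA.
  by rewrite -addrA [a t + (a s - a t)]addrC subrK [a t + a s]addrC.
rewrite /is_derive_in; under eq_fun do rewrite quotE.
(* The limit is put in the shape of the quotient, with [0] as the limit of [s - t] and [da] as that
   of [q s], so that the limit rules apply factor by factor. *)
have -> : inner da (K *m a t) =
    2^-1 * inner da (K *m (a t + a t + 0 *: da)).
  by rewrite scale0r addr0 mulmxDr innerDr mulrC mulrDl -splitr.
apply: cvgM; first exact: cvg_cst.
apply: cvg_inner_mulmxr; first exact: dat.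
apply: cvgD; first exact: cvg_cst.
apply: cvgZ; last exact: dat.
(* Here [s] tends to [t] because restricting to [I] and removing [t] only refine the neighbourhood
   filter. *)
rewrite -(subrr t); apply: cvgB; last exact: cvg_cst.
by apply: cvg_within_filter; exact: nbhs_dnbhs.
Qed.

(** Moving the outer factor [mobility0] across the bracket leaves the form of [Ga + Gs] at the
    vector [mobility0 g Psi *m w]. *)
Lemma mobility_ge0 (R : realType) N (Ga Gs : 'M[R]_N) (g : R -> R)
    (Psi w : 'cV[R]_(N + N)) :
  Ga \is skewmx -> psdmx Gs -> 0 <= inner w (mobility Ga Gs g Psi *m w).
Proof.
move=> Gask [_ Gs0]; rewrite /mobility -!mulmxA inner_mulmx trmxK.
by rewrite mulmxDl innerDr inner_skew// add0r Gs0.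
Qed.

Lemma trmx_linop (R : realType) N (L0 : 'M[R]_N) :
  L0^T = L0 -> (linop L0)^T = linop L0.
Proof. by move=> L0t; rewrite /linop tr_block_mx L0t !trmx0 trmx1. Qed.

Theorem theorem3p2 (R : realType) (N r : nat)
    (hN : (1 <= N)%N) (hr : (1 <= r <= N)%N)
    (L0 : 'M[R]_N) (hL0 : psdmx L0) (hL0inv : L0 \in unitmx)
    (Ga Gs : 'M[R]_N) (hGa : Ga \is skewmx) (hGs : psdmx Gs)
    (g : R -> R)
    (Uphi Uq : 'M[R]_(N, r))
    (hUphi : Uphi^T *m Uphi = 1%:M) (hUq : Uq^T *m Uq = 1%:M)
    (I : interval R) (a : R -> 'cV[R]_(r + r)) :
  let L := linop L0 in
  let M := mobility Ga Gs g in
  let U := reduced_basis Uphi Uq in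
  pod_rom_II_solution L M U I a ->
  forall t : R, t \in I ->
    let w := L *m (U *m a t) in
    is_derive_in I (fun s => energy L (U *m a s)) t
      (- inner w (M (U *m a t) *m w))
    /\ - inner w (M (U *m a t) *m w) <= 0.
Proof.
move=> L M U sol t tI w.
have Lt : L^T = L by apply/trmx_linop/trmx_symmetric; case: hL0.
split; last by rewrite oppr_le0 mobility_ge0.
have [da dat eq_da] := sol t tI.
pose K := U^T *m L *m U.
have Kt : K^T = K by rewrite /K !trmx_mul trmxK Lt mulmxA.
have energyE : (fun s => energy L (U *m a s)) =
    (fun s => 2^-1 * inner (a s) (K *m a s)).
  by apply/funext => s; rewrite /energy /inner /K trmx_mul !mulmxA.
have -> : - inner w (M (U *m a t) *m w) = inner da (K *m a t).
  (* Symmetry of [K] moves it onto [da]; writing its inner [L] as [L^T] then exposes the left-hand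
     side of the reduced model. *)
  rewrite [RHS]inner_mulmx Kt [RHS]innerC {1}/K -{1}Lt eq_da innerNr.
  congr (- _).
  (* The factors [U^T] and [L^T] return to the left argument and turn [a t] into [w]. *)
  by rewrite -!mulmxA [RHS]inner_mulmx trmxK [RHS]inner_mulmx trmxK.
by rewrite energyE; exact: is_derive_in_quadratic.
Qed.
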